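(* Let $G$ be a virtually nilpotent group, let $A\subseteq G$ be finite and non-empty, and set $\Gamma:=\langle A\rangle$. Let $S\subseteq\Gamma$ be a finite symmetric generating set of $\Gamma$ with $e\in S$. Suppose that there exist a real number $\theta>0$ and $h_1\in\mathbb N$ such that \[ B_S(\lfloor\theta h\rfloor)\subseteq A^h \] for every integer $h\ge h_1$. Then $A$ is an asymptotic approximate group.
   Context: $\mathbb N=\{1,2,3,\dots\}$. For subsets $E,F$ of a group $G$: $EF=\{ef:e\in E,f\in F\}$, $E^{-1}=\{e^{-1}:e\in E\}$, $E^0=\{e\}$, and for $h\ge1$, $E^h$ is the set of products of exactly $h$ elements of $E$. $E$ is symmetric if $E^{-1}=E$. $\langle E\rangle$ is the subgroup generated by $E$. A group is virtually nilpotent if it contains a nilpotent subgroup of finite index (it need not be finitely generated). For a finite symmetric generating set $S\ni e$ of a group $\Gamma$, $\ell_S(g)=\min\{n\ge0:g\in S^n\}$ and $B_S(n)=\{g\in\Gamma:\ell_S(g)\le n\}$ (so $B_S(n)=S^n$ for integers $n\ge 0$). For $r,l\in\mathbb N$, a non-empty set $A\subseteq G$ is an asymptotic $(r,l)$-approximate group if there is $h_0\in\mathbb N$ such that for every integer $h\ge h_0$ there is a set $X_h\subseteq G$ with $|X_h|\le l$ and $A^{rh}\subseteq X_hA^h$. $A$ is an asymptotic approximate group if for every $r\in\mathbb N$ there exists $l=l(A,r)\in\mathbb N$ such that $A$ is an asymptotic $(r,l)$-approximate group. *)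

(* Defs.v *)
From HB Require Import structures.
From mathcomp Require Import all_boot all_order all_algebra.
From mathcomp Require Import all_classical reals.

Set Implicit Arguments.
Unset Strict Implicit.
Unset Printing Implicit Defensive.

Local Open Scope group_scope.
Local Open Scope classical_set_scope.

Section Groups.
Variable G : groupType.
Implicit Types (A E F H S : set G) (g x y : G).

Definition set_mulg E F : set G := [set x * y | x in E & y in F].

Definition set_invg E : set G := [set x^-1 | x in E].

Definition set_expg E (n : nat) : set G := iter n (set_mulg E) [set 1].

Definition is_subgroup H : Prop :=
  [/\ H 1, (forall x y, H x -> H y -> H (x * y)) & (forall x, H x -> H x^-1)].

Definition generated E : set G := smallest is_subgroup E.

Definition symmetric_set E : Prop := set_invg E = E.

Fixpoint lower_central H (n : nat) : set G :=
  if n is m.+1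
  then generated [set [~ x, y] | x in lower_central H m & y in H]
  else H.

Definition nilpotent_subgroup H : Prop :=
  is_subgroup H /\ exists c : nat, lower_central H c = [set 1].

Definition finite_index H : Prop :=
  finite_set [set [set x * y | y in H] | x in [set: G]].

(* The value is meaningful only when some power of S contains g, which is the
   case for all g in the subgroup generated by S if S is symmetric and
   contains 1; elsewhere it is the junk value 0. *)
Definition word_length S g : nat :=
  if pselect (exists n, `[< set_expg S n g >]) is left ex then ex_minn ex
  else 0%N.

(* The membership in generated S excludes the junk values of word_length. *)
Definition word_ball S (n : int) : set G :=
  [set g | generated S g /\ ((word_length S g)%:Z <= n)%R].

(* X #<= `I_l says that X is finite with at most l elements. *)
Definition asymptotic_rl_approximate_group (r l : nat) A : Prop :=
  A !=set0 /\
  exists2 h0 : nat, (0 < h0)%N &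
    forall h : nat, (h0 <= h)%N ->
      exists2 X : set G, (X #<= `I_l)%card &
        set_expg A (r * h)%N `<=` set_mulg X (set_expg A h).

Definition asymptotic_approximate_group A : Prop :=
  forall r : nat, (0 < r)%N ->
    exists2 l : nat, (0 < l)%N & asymptotic_rl_approximate_group r l A.

End Groups.

Definition virtually_nilpotent (G : groupType) : Prop :=
  exists2 H : set G, nilpotent_subgroup H & finite_index H.

(* Main.v *)
(* Since A is contained in some S^k, it suffices to cover B_S(C n) by a number of
   translates of B_S(B n) that is bounded uniformly in n, with B independent of C.

   For a nilpotent group generated by S, write elements as words in iterated
   commutators of elements of S, where a commutator of weight w costs n^-w.
   Conjugation by a word of cost D multiplies the cost of a word by at most e^D,
   because [z^-1 u z = u [u, z]], and commutators of words have bounded cost. An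
   element of B_S(C n) is a word of cost C; remove its letters by increasing
   weight. A letter z of weight i occurs m <= K n^i times; collect these
   occurrences on the left and write m = q n^i + r with r < n^i. There are boundedly
   many z^(q n^i), which enter the translating set, while z^r is, up to letters of
   weight > i, a product of O(n) elements of S, which is moved to the right. All
   this takes place at the level of words, so that torsion and relations in the
   successive quotients of the lower central series play no role. Schreier's
   generators reduce the virtually nilpotent case to the nilpotent one. *)

Require Import Defs.
From HB Require Import structures.
From mathcomp Require Import all_boot all_order all_algebra.
From mathcomp Require Import all_classical reals.
From mathcomp Require Import sequences exp zify ring lra.

Set Implicit Arguments.
Unset Strict Implicit.
Unset Printing Implicit Defensive.

Import Order.TTheory GRing.Theory Num.Theory.

Local Open Scope group_scope.
Local Open Scope classical_set_scope.

Ltac mulg_norm :=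
  rewrite ?(commgEl, conjgE, invgM, invgK, invg1, mulg1, mul1g, mulgA,
            mulgK, mulgVK, mulVg, mulgV).

Lemma commMg_conj (G : groupType) (x y z : G) :
  [~ x * y, z] = [~ x, z] ^ y * [~ y, z].
Proof. by mulg_norm. Qed.

Lemma commgM_conj (G : groupType) (x y z : G) :
  [~ x, y * z] = [~ x, z] * [~ x, y] ^ z.
Proof. by mulg_norm. Qed.

Lemma expR_ge1 (R : realType) (x : R) : (0 <= x -> 1 <= expR x)%R.
Proof. by rewrite -[in X in _ -> X]expR0 ler_expR. Qed.

(** * Words in iterated commutators and their cost *)

Section CommutatorWords.
Variables (R : realType) (G : groupType).
Implicit Types (S : set G) (C D eps : R) (g h u v z : G).

Inductive iter_comm S : nat -> G -> Prop :=
| iter_comm_gen s : S s -> iter_comm S 1 s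
| iter_comm_commg p q u v :
    iter_comm S p u -> iter_comm S q v -> iter_comm S (p + q) [~ u, v].

(* [eps] is meant to be [1 / n], so that cost [C] allows [C * n ^ w] letters of
   weight [w]. The real argument is only an upper bound for the cost. *)
Inductive word (P : nat -> G -> Prop) eps : R -> G -> Prop :=
| word_nil C : (0 <= C)%R -> word P eps C 1
| word_cons w u C g D : P w u -> word P eps C g -> (eps ^+ w + C <= D)%R ->
    word P eps D (u * g).

(** A quantitative stand-in for the [i]-th term, counted from 1, of the lower central series. *)
Definition comm_word S eps (i : nat) : R -> G -> Prop :=
  word (fun w u => iter_comm S w u /\ (i <= w)%N) eps.

Lemma iter_comm_gt0 S w u : iter_comm S w u -> (0 < w)%N.
Proof. by elim=> // p q ? ? _ p_gt0 _ _; rewrite addn_gt0 p_gt0. Qed.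

Lemma iter_commV S w u : (forall s, S s -> S s^-1) ->
  iter_comm S w u -> iter_comm S w u^-1.
Proof.
move=> SV; case=> [s /SV Ss|p q {}u v pu qv]; first exact: iter_comm_gen.
by rewrite invgR addnC; apply: iter_comm_commg.
Qed.

Section Word.
Variables (P : nat -> G -> Prop) (eps : R).
Hypothesis eps_ge0 : (0 <= eps)%R.

Lemma word_ge0 C g : word P eps C g -> (0 <= C)%R.
Proof.
elim=> // w u {}C {}g D _ _ C_ge0; apply: le_trans.
by rewrite addr_ge0 ?exprn_ge0.
Qed.

Lemma word_le C D g : word P eps C g -> (C <= D)%R -> word P eps D g.
Proof.
case=> [{}C C0|w u {}C {}g C' Pu Pg le_C'] CD.
  exact/word_nil/(le_trans C0).
exact: word_cons Pu Pg (le_trans le_C' CD).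
Qed.

Lemma word_sub (Q : nat -> G -> Prop) C g :
  (forall w u, P w u -> Q w u) -> word P eps C g -> word Q eps C g.
Proof.
move=> PQ; elim=> [{}C|w u {}C {}g D /PQ Qu _ Qg]; first exact: word_nil.
exact: word_cons.
Qed.

Lemma word_mul C D g h :
  word P eps C g -> word P eps D h -> word P eps (C + D) (g * h).
Proof.
move=> Pg Ph; elim: Pg => [{}C C0|w u {}C {}g C' Pu _ IH le_C'].
  by rewrite mul1g; apply: word_le Ph _; rewrite lerDr.
by rewrite -mulgA; apply: word_cons Pu IH _; rewrite addrA lerD2r.
Qed.

Lemma word_letter w u : P w u -> word P eps (eps ^+ w)%R u.
Proof.
move=> Pu; rewrite -[u]mulg1; apply: word_cons Pu (word_nil _ _ (lexx _)) _.
by rewrite addr0.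
Qed.

Lemma wordV C g : (forall w u, P w u -> P w u^-1) ->
  word P eps C g -> word P eps C g^-1.
Proof.
move=> PV; elim=> [{}C|w u {}C {}g D /PV Pu _ Pg le_D].
  by rewrite invg1; apply: word_nil.
rewrite invgM; apply: word_le (word_mul Pg (word_letter Pu)) _.
by rewrite addrC.
Qed.

Lemma word_exp C g a :
  word P eps C g -> word P eps (a%:R * C)%R (g ^+ a).
Proof.
move=> Pg; elim: a => [|a IH]; first by rewrite mul0r expg0; apply: word_nil.
rewrite expgS; apply: word_le (word_mul Pg IH) _.
by rewrite -natr1 mulrDl mul1r addrC.
Qed.

End Word.

(** * Cost of conjugates, commutators and powers *)

Section CommWord.
Variables (S : set G) (eps : R).
Hypotheses (eps_ge0 : (0 <= eps)%R) (eps_le1 : (eps <= 1)%R).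
Hypothesis SV : forall s, S s -> S s^-1.

Local Notation V := (comm_word S eps).

Lemma comm_word_weight i j C g : (j <= i)%N -> V i C g -> V j C g.
Proof. by move=> ji; apply: word_sub => w u [Su /(leq_trans ji)]. Qed.

Lemma comm_wordV i C g : V i C g -> V i C g^-1.
Proof. by apply: wordV => // w u [Su ?]; split=> //; apply: iter_commV. Qed.

Lemma comm_word_letter w z : iter_comm S w z -> V w (eps ^+ w)%R z.
Proof. by move=> Sz; apply: word_letter. Qed.

(** Each letter [u] of weight [w'] becomes [u * [~ u, z]], and the new letter costs
    [eps ^+ w' * eps ^+ w]. *)
Lemma comm_word_conj_letter i C g w z : iter_comm S w z -> V i C g ->
  V i (C * (1 + eps ^+ w))%R (g ^ z).
Proof.
move=> Sz; have ew : (0 <= eps ^+ w)%R by rewrite exprn_ge0.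
elim=> [{}C C0|w' u {}C {}g D [Su iw'] Vg IH le_D].
  by rewrite conj1g; apply: word_nil; rewrite mulr_ge0 ?addr_ge0.
rewrite conjMg -(mulVKg u (u ^ z)) -commgEl -mulgA.
have Suz : iter_comm S (w' + w) [~ u, z] by apply: iter_comm_commg.
have iww' : (i <= w' + w)%N by rewrite (leq_trans iw') ?leq_addr.
apply: (word_cons (conj Su iw') (word_cons (conj Suz iww') IH (lexx _))).
rewrite exprD addrA -[X in (X + _ * _ + _)%R]mulr1 -mulrDr -mulrDl.
by rewrite ler_wpM2r ?addr_ge0.
Qed.

(** The letters of [h] conjugate in turn; the factors [1 + eps ^+ w] multiply to at most
    [expR D]. *)
Lemma comm_word_conj i j C D g h : V i C g -> V j D h ->
  V i (C * expR D)%R (g ^ h).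
Proof.
move=> + Vh; elim: Vh C g => [{}D D0|w z {}D {}h D' [Sz _] Vh IH le_D'] C g Vg.
  rewrite conjg1; apply: (word_le (Vg)).
  by rewrite ler_peMr ?(word_ge0 eps_ge0 Vg) // expR_ge1.
have C0 := word_ge0 eps_ge0 Vg.
rewrite conjgM; apply: (word_le (IH _ _ (comm_word_conj_letter Sz Vg))).
rewrite -mulrA ler_wpM2l //; apply: (@le_trans _ _ (expR (eps ^+ w + D)%R)).
  by rewrite expRD ler_wpM2r ?expR_ge0 ?expR_ge1Dx.
by rewrite ler_expR.
Qed.

Lemma comm_word_comm_letter i C g w z : V i C g -> iter_comm S w z ->
  V (i + w) (C * eps ^+ w * expR C)%R [~ g, z].
Proof.
move=> Vg Sz; have ew : (0 <= eps ^+ w)%R by rewrite exprn_ge0.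
elim: Vg => [{}C C0|w' u {}C {}g D [Su iw'] Vg IH le_D].
  by rewrite comm1g; apply: word_nil; rewrite !mulr_ge0 ?expR_ge0.
have C0 := word_ge0 eps_ge0 Vg.
rewrite commMg_conj.
have Suz : V (i + w) (eps ^+ (w' + w))%R [~ u, z].
  apply: (@comm_word_weight (w' + w)); first by rewrite leq_add2r.
  by apply: comm_word_letter; apply: iter_comm_commg.
apply: (word_le (word_mul (comm_word_conj Suz Vg) IH)).
rewrite exprD -!mulrA -mulrDl; apply: ler_pM => //.
- by rewrite addr_ge0 ?exprn_ge0.
- by rewrite mulr_ge0 ?expR_ge0.
rewrite ler_wpM2l // ler_expR; apply: le_trans le_D.
by rewrite lerDr exprn_ge0.
Qed.

(** Splitting both arguments into letters leaves one commutator per pair of letters, hence the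
    product [C * D]; conjugation by the remaining letters of [g] and [h] causes the factor
    [expR (C + D)]. *)
Lemma comm_word_comm i j C D g h : V i C g -> V j D h ->
  V (i + j) (C * D * expR (C + D))%R [~ g, h].
Proof.
move=> Vg; have C0 := word_ge0 eps_ge0 Vg.
elim=> [{}D D0|w z {}D {}h D' [Sz jw] Vh IH le_D'].
  by rewrite commg1; apply: word_nil; rewrite !mulr_ge0 ?expR_ge0.
have D0 := word_ge0 eps_ge0 Vh.
have ew : (0 <= eps ^+ w)%R by rewrite exprn_ge0.
rewrite commgM_conj.
have Vgz : V (i + j) (C * eps ^+ w * expR C)%R [~ g, z].
  apply: (comm_word_weight _ (comm_word_comm_letter Vg Sz)).
  by rewrite leq_add2l.
apply: (word_le (word_mul IH (comm_word_conj Vgz Vh))).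
rewrite -[X in (_ + X)%R]mulrA -expRD -mulrDl -mulrDr.
apply: ler_pM; rewrite ?mulr_ge0 ?addr_ge0 ?expR_ge0 //.
  by rewrite ler_wpM2l // addrC.
by rewrite ler_expR lerD2l (le_trans _ le_D') // lerDr.
Qed.

(** Collecting the copies of [t] on the left conjugates each [e] by a power of [t] of cost at most
    [a%:R * D]. *)
Lemma comm_word_exp_mul k i C D t e a : V k C e -> V i D t ->
  exists2 E, V k (a%:R * (C * expR (a%:R * D)))%R E & (t * e) ^+ a = t ^+ a * E.
Proof.
move=> Ve Vt; have C0 := word_ge0 eps_ge0 Ve; have D0 := word_ge0 eps_ge0 Vt.
elim: a => [|a [E VE IH]].
  by exists 1; rewrite ?expg0 ?mulg1 //; apply: word_nil; rewrite !mul0r.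
exists (e ^ (t ^+ a) * E); last first.
  by rewrite expgS IH expgS; mulg_norm.
apply: (word_le (word_mul (comm_word_conj Ve (word_exp a Vt)) VE)).
have leE : (expR (a%:R * D) <= expR (a.+1%:R * D))%R.
  by rewrite ler_expR ler_wpM2r // ler_nat.
move: (expR (a.+1%:R * D)%R) leE => x leE.
by rewrite -natr1 [in leRHS]mulrDl mul1r [leRHS]addrC lerD // !ler_wpM2l.
Qed.

(* As the cost of [u ^+ a] is at most 1, the error is linear in the cost [D] of
   [h]; this is what allows the lemma to be used a second time, in [h]. *)
Definition comm_exp_cost : R := (expR 2 * expR (expR 2 + 1) * expR (expR 2))%R.

Lemma comm_exp_cost_ge1 : (1 <= comm_exp_cost)%R.
Proof. by rewrite !mulr_ege1 ?expR_ge1 ?addr_ge0 ?expR_ge0. Qed.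

Lemma comm_word_comm_exp p q D u h a : iter_comm S p u -> V q D h ->
  (D <= 1)%R -> (a%:R * eps ^+ p <= 1)%R ->
  exists2 E, V (p + q).+1 (D * comm_exp_cost)%R E &
    [~ u ^+ a, h] = [~ u, h] ^+ a * E.
Proof.
move=> Su Vh D1 a1; have D0 := word_ge0 eps_ge0 Vh.
have ep0 : (0 <= eps ^+ p)%R by rewrite exprn_ge0.
have ep1 : (eps ^+ p <= 1)%R by rewrite exprn_ile1.
have K0 : (0 <= comm_exp_cost)%R := le_trans ler01 comm_exp_cost_ge1.
have e0 (x : R) : (0 <= expR x)%R by exact: expR_ge0.
(* The induction needs an error proportional to [a]; the hypothesis on [a] turns it into the uniform
   bound. *)
suff [E VE eqE] : exists2 E,
    V (p + q).+1 (a%:R * eps ^+ p * (D * comm_exp_cost))%R E &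
    [~ u ^+ a, h] = [~ u, h] ^+ a * E.
  by exists E => //; apply: (word_le VE); rewrite ler_piMl ?mulr_ge0.
set t := [~ u, h].
have Vt : V (p + q) (eps ^+ p * D * expR 2)%R t.
  apply: (word_le (comm_word_comm (comm_word_letter Su) Vh)).
  by rewrite ler_wpM2l ?mulr_ge0 // ler_expR; lra.
have t_le : (eps ^+ p * D * expR 2 <= expR 2)%R.
  by rewrite ler_piMl // mulr_ile1.
elim: a a1 => [|a IH] a1.
  by exists 1; [apply: word_nil; rewrite !mul0r|rewrite !expg0 comm1g mulg1].
have {}a1 : (a%:R * eps ^+ p <= 1)%R.
  by apply: le_trans a1; rewrite ler_wpM2r // ler_nat.
have [E VE eqE] := IH a1.
have Vua : V p 1 (u ^+ a) := word_le (word_exp a (comm_word_letter Su)) a1.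
have Vta : V (p + q) (expR 2) (t ^+ a).
  apply: (word_le (word_exp a Vt)).
  by rewrite !mulrA ler_piMl // mulr_ile1 // mulr_ge0.
(* [[~ u * u ^+ a, h] = t ^ (u ^+ a) * [~ u ^+ a, h]], where [t ^ (u ^+ a) = t * [~ t, u ^+ a]]. *)
exists ([~ t, u ^+ a] ^ (t ^+ a) * E); last first.
  by rewrite expgS commMg_conj eqE -/t expgS; clearbody t; mulg_norm.
apply: word_le (word_mul (comm_word_conj _ Vta) VE) _.
  apply: comm_word_weight (comm_word_comm Vt Vua).
  by rewrite -addn1 leq_add2l (iter_comm_gt0 Su).
have -> : (a.+1%:R = a%:R + 1 :> R)%R by rewrite natr1.
rewrite [in leRHS]mulrDl mul1r [in leRHS]mulrDl [leRHS]addrC lerD2r mulr1.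
rewrite /comm_exp_cost.
rewrite !mulrA ler_wpM2r // ler_wpM2l ?mulr_ge0 // ler_expR lerD2r //.
Qed.

(** Bilinearity of the commutator modulo higher weight: the power is taken in the second variable
    first, through [[~ v, u] = [~ u, v]^-1], and then in the first. *)
Lemma comm_word_commX p q a m u v : iter_comm S p u -> iter_comm S q v ->
  (a%:R * eps ^+ p <= 1)%R -> (m%:R * eps ^+ q <= 1)%R ->
  exists2 E, V (p + q).+1 (comm_exp_cost * (expR 2 + 1))%R E &
    [~ u, v] ^+ (m * a) = [~ u ^+ a, v ^+ m] * E.
Proof.
move=> Su Sv a1 m1; set K := comm_exp_cost; set z := [~ u, v].
have K0 : (0 <= K)%R := le_trans ler01 comm_exp_cost_ge1.
have e0 (x : R) : (0 <= expR x)%R by exact: expR_ge0.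
have ep0 : (0 <= eps ^+ p)%R by rewrite exprn_ge0.
have ep1 : (eps ^+ p <= 1)%R by rewrite exprn_ile1.
have Vz : V (p + q) (m%:R * eps ^+ (p + q))%R (z ^+ m).
  by apply: word_exp; apply: comm_word_letter; apply: iter_comm_commg.
have mz : (m%:R * eps ^+ (p + q) <= eps ^+ p)%R.
  by rewrite exprD mulrCA ler_piMr.
have amz : (a%:R * (m%:R * eps ^+ (p + q)) <= 1)%R.
  by apply: le_trans a1; rewrite ler_wpM2l.
(* With [D = eps ^+ p], the error [E0] is cheap enough for [a] conjugates of its inverse to have
   bounded total cost. *)
have [E0 VE0 eqE0] := comm_word_comm_exp Sv (comm_word_letter Su) ep1 m1.
have {}eqE0 : [~ u, v ^+ m] = z ^+ m * (E0^-1 ^ (z ^+ m)).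
  rewrite -invgR eqE0 -(invgR u v) -/z.
  by clearbody z; rewrite invgM expVgn invgK -conjgC.
have Ve : V (p + q).+1 (eps ^+ p * K * expR 1)%R (E0^-1 ^ (z ^+ m)).
  rewrite addnC in VE0; apply: word_le (comm_word_conj (comm_wordV VE0) Vz) _.
  by rewrite ler_wpM2l ?mulr_ge0 // ler_expR (le_trans mz).
have Vvm : V q 1 (v ^+ m) := word_le (word_exp m (comm_word_letter Sv)) m1.
have [E1 VE1 eqE1] := comm_word_comm_exp Su Vvm (lexx _) a1.
have [E2 VE2 eqE2] := comm_word_exp_mul a Ve Vz.
exists (E2 * E1)^-1; last first.
  by rewrite eqE1 eqE0 eqE2 expgnA; mulg_norm.
apply: comm_wordV; apply: word_le (word_mul VE2 VE1) _.
rewrite mul1r [leRHS]mulrDr mulr1 lerD2r.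
apply: (@le_trans _ _ ((a%:R * eps ^+ p) * (K * expR 1 * expR 1))%R).
  by rewrite !mulrA ler_wpM2l ?mulr_ge0 // ler_expR -mulrA.
have -> : (K * expR 1 * expR 1 = K * expR 2)%R.
  by rewrite -mulrA -expRD.
by rewrite ler_piMl ?mulr_ge0.
Qed.

End CommWord.

(** * Powers of a subset of a group *)

Lemma set_expg_mul S a b g h :
  set_expg S a g -> set_expg S b h -> set_expg S (a + b) (g * h).
Proof.
move=> Sg Sh; elim: a g Sg => [g ->|a IH g [s Ss [g' /IH Sg' <-]]].
  by rewrite mul1g.
by exists s => //; exists (g' * h) => //; rewrite mulgA.
Qed.

Lemma set_expg1 S s : S s -> set_expg S 1 s.
Proof. by move=> Ss; exists s => //; exists 1 => //; rewrite mulg1. Qed.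

Lemma set_expg_pow S a g m : set_expg S a g -> set_expg S (m * a) (g ^+ m).
Proof.
move=> Sg; elim: m => [//|m IH]; rewrite expgS mulSn; exact: set_expg_mul.
Qed.

Lemma set_expg_powM S a b g :
  set_expg (set_expg S a) b g -> set_expg S (b * a) g.
Proof.
elim: b g => [//|b IH g [s Ss [g' /IH Sg' <-]]].
by rewrite mulSn; apply: set_expg_mul.
Qed.

Lemma set_expg_subset S S' a : S `<=` S' -> set_expg S a `<=` set_expg S' a.
Proof.
move=> SS'; elim: a => [//|a IH g [s /SS' Ss [g' /IH Sg' <-]]].
by exists s => //; exists g'.
Qed.

Lemma set_expg_le S a b g : S 1 -> (a <= b)%N -> set_expg S a g -> set_expg S b g.
Proof.
move=> S1 /subnK <- Sg; rewrite -[g]mul1g; apply: set_expg_mul => //.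
by elim: (b - a)%N => [//|m IH]; exists 1 => //; exists 1 => //; rewrite mul1g.
Qed.

Lemma set_expgV S a g : (forall s, S s -> S s^-1) ->
  set_expg S a g -> set_expg S a g^-1.
Proof.
move=> SV; elim: a g => [g ->|a IH g [s Ss [g' /IH Sg' <-]]].
  by rewrite invg1.
by rewrite invgM -addn1; apply: set_expg_mul => //; apply/set_expg1/SV.
Qed.

Lemma set_expg_word S eps a g :
  set_expg S a g -> comm_word S eps 1 (a%:R * eps)%R g.
Proof.
elim: a g => [g ->|a IH g [s Ss [g' /IH Sg' <-]]].
  by apply: word_nil; rewrite mul0r.
apply: word_cons Sg' _; first by split; [exact: iter_comm_gen|].
by rewrite expr1 -natr1 mulrDl mul1r addrC.
Qed.

Lemma invn_ge0 n : (0 <= n%:R^-1 :> R)%R.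
Proof. by rewrite invr_ge0. Qed.

Lemma invn_le1 n : (0 < n)%N -> (n%:R^-1 <= 1 :> R)%R.
Proof. by move=> n0; rewrite invf_le1 ?ltr0n // ler1n. Qed.

Lemma natr_invX_le1 a n i : (0 < n)%N -> (a <= n ^ i)%N ->
  (a%:R * n%:R^-1 ^+ i <= 1 :> R)%R.
Proof.
move=> n0 an; rewrite exprVn ler_pdivrMr ?exprn_gt0 ?ltr0n // mul1r.
by rewrite -natrX ler_nat.
Qed.

(** * Powers of iterated commutators near balls *)

Section Balls.
Variable S : set G.
Hypotheses (SV : forall s, S s -> S s^-1) (S1 : S 1).

Local Notation V n := (comm_word S (n%:R^-1 : R)%R).

Lemma ball_word L n b : (0 < n)%N -> set_expg S (L * n)%N b -> V n 1 L%:R%R b.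
Proof.
move=> n0 /(set_expg_word n%:R^-1%R); rewrite natrM mulfK //.
by rewrite pnatr_eq0 -lt0n.
Qed.

(** [[~ u ^+ a, v ^+ m]] is compared with [[~ b1, b2]], a product of four ball elements. The
    corrections [[~ e1, v ^+ m]] and [[~ b1, e2]] have weight above [p + q]. *)
Lemma comm_exp_near_ball p q u v K1 L1 K2 L2 a m n : (0 < n)%N ->
  iter_comm S p u -> iter_comm S q v -> (a <= n ^ p)%N -> (m <= n ^ q)%N ->
  (exists e b, [/\ V n p.+1 K1 e, set_expg S (L1 * n)%N b & u ^+ a = e * b]) ->
  (exists e b, [/\ V n q.+1 K2 e, set_expg S (L2 * n)%N b & v ^+ m = e * b]) ->
  exists e b, [/\ V n (p + q).+1
    (K1 * expR (K1 + 1) * expR (K1 + 1) +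
     ((K1 + 1) * K2 * expR (K1 + 1 + K2) * expR (K2 + 1) +
      comm_exp_cost * (expR 2 + 1)) * expR (2 * (L1 + L2))%N%:R)%R e,
    set_expg S (2 * (L1 + L2) * n)%N b & [~ u, v] ^+ (m * a) = e * b].
Proof.
move=> n0 Su Sv an mn [e1 [b1 [Ve1 Sb1 eq1]]] [e2 [b2 [Ve2 Sb2 eq2]]].
have n'0 := invn_ge0 n; have n'1 := invn_le1 n0.
have a1 := natr_invX_le1 n0 an; have m1 := natr_invX_le1 n0 mn.
have [E VE eqE] := comm_word_commX n'0 n'1 SV Su Sv a1 m1.
have Vua : V n p 1%R (u ^+ a) := word_le (word_exp a (comm_word_letter _ Su)) a1.
have Vvm : V n q 1%R (v ^+ m) := word_le (word_exp m (comm_word_letter _ Sv)) m1.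
(* Lying in a ball only gives [b1] weight 1; weight at least [p] comes from
   [b1 = e1^-1 * u ^+ a]. *)
have Vb1 : V n p (K1 + 1)%R b1.
  rewrite -(mulKg e1 b1) -eq1; apply: word_mul => //.
  by apply: comm_wordV => //; apply: comm_word_weight Ve1.
have Vb2 : V n q (K2 + 1)%R b2.
  rewrite -(mulKg e2 b2) -eq2; apply: word_mul => //.
  by apply: comm_wordV => //; apply: comm_word_weight Ve2.
have SB : set_expg S (2 * (L1 + L2) * n)%N [~ b1, b2].
  have -> : (2 * (L1 + L2) * n = L1 * n + (L2 * n + (L1 * n + L2 * n)))%N by lia.
  rewrite commgEl conjgE; do ?apply: set_expg_mul => //; exact: set_expgV.
have VB := ball_word n0 (set_expgV SV SB).
exists ([~ e1, v ^+ m] ^ b1 * ([~ b1, e2] ^ b2 * E) ^ [~ b1, b2]^-1), [~ b1, b2].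
split => //; last first.
  rewrite eqE eq1 commMg_conj eq2 (commgM_conj b1).
  move: [~ b1, b2] [~ e1, _] [~ b1, e2] => x y z.
  by mulg_norm.
apply: word_mul.
  apply: (comm_word_conj n'0) Vb1; rewrite -[X in V n X]addSn.
  by move: (comm_word_comm n'0 Ve1 Vvm); rewrite mulr1.
apply: (comm_word_conj n'0) VB; apply: word_mul => //.
apply: (comm_word_conj n'0) Vb2; rewrite -[X in V n X]addnS.
exact: comm_word_comm.
Qed.

(* Write [r = a * n ^ q + d] and apply the previous lemma to [(a, n ^ q)] and
   [(1, d)]. *)
Lemma iter_comm_exp_near_ball i z : iter_comm S i z ->
  exists K L, forall n r, (0 < n)%N -> (r <= n ^ i)%N ->
  exists e b, [/\ V n i.+1 K e, set_expg S (L * n)%N b & z ^+ r = e * b].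
Proof.
elim=> [s Ss|p q u v Su [K1 [L1 IH1]] Sv [K2 [L2 IH2]]].
  exists 0%R, 1%N => n r n0; rewrite expn1 => rn.
  exists 1, (s ^+ r); split; rewrite ?mul1g //; first exact: word_nil.
  apply: (set_expg_le S1 (a := (r * 1)%N)); first by lia.
  exact/set_expg_pow/set_expg1.
pose K : R := (K1 * expR (K1 + 1) * expR (K1 + 1) +
     ((K1 + 1) * K2 * expR (K1 + 1 + K2) * expR (K2 + 1) +
      comm_exp_cost * (expR 2 + 1)) * expR (2 * (L1 + L2))%N%:R)%R.
pose L := (2 * (L1 + L2))%N.
exists (K + K * expR L%:R)%R, (L + L)%N => n r n0 rn.
have nq0 : (0 < n ^ q)%N by rewrite expn_gt0 n0.
have near a m : (a <= n ^ p)%N -> (m <= n ^ q)%N -> exists e b,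
    [/\ V n (p + q).+1 K e, set_expg S (L * n)%N b & [~ u, v] ^+ (m * a) = e * b].
  by move=> an mn; apply: comm_exp_near_ball => //; [exact: IH1|exact: IH2].
have [e [b [Ve Sb eqb]]] : exists e b, [/\ V n (p + q).+1 K e,
    set_expg S (L * n)%N b & [~ u, v] ^+ (n ^ q * (r %/ n ^ q)) = e * b].
  by apply: near => //; rewrite -(mulnK (n ^ p) nq0) leq_div2r // -expnD.
have [e' [b' [Ve' Sb' eqb']]] : exists e b, [/\ V n (p + q).+1 K e,
    set_expg S (L * n)%N b & [~ u, v] ^+ (r %% n ^ q * 1) = e * b].
  by apply: near => //; rewrite ?expn_gt0 ?n0 // ltnW ?ltn_mod.
exists (e * e' ^ b^-1), (b * b'); split.
- apply: word_mul => //; apply: (comm_word_conj (invn_ge0 n) Ve').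
  by apply: ball_word => //; apply: set_expgV Sb.
- by rewrite mulnDl; apply: set_expg_mul.
rewrite [in LHS](divn_eq r (n ^ q)) expgnDr mulnC eqb -[(r %% _)%N]muln1 eqb'.
by mulg_norm.
Qed.

(** * Collection of letters by increasing weight *)

Definition letter_from i (L : seq G) w u : Prop :=
  iter_comm S w u /\ ((i < w)%N \/ w = i /\ u \in L).

Lemma comm_word_letter_from n i L C g :
  V n i.+1 C g -> word (letter_from i L) n%:R^-1%R C g.
Proof. by apply: word_sub => w u [Su iw]; split=> //; left. Qed.

Lemma letter_from_comm_word n i L C g :
  word (letter_from i L) n%:R^-1%R C g -> V n i C g.
Proof.
by apply: word_sub => w u [Su wu]; split=> //; case: wu => [/ltnW|[->]].
Qed.

(** Moving [z ^+ m] to the left past a letter [u] leaves [[~ u, z ^+ m]], of weight above [i], so no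
    new occurrence of [z] has to be collected. It costs at most [C * expR C] times as much as
    [u]. *)
Lemma word_extract n i z L C g : (0 < n)%N -> iter_comm S i z ->
  word (letter_from i (z :: L)) n%:R^-1%R C g ->
  exists m g', [/\ (m%:R * n%:R^-1 ^+ i <= C)%R,
    word (letter_from i L) n%:R^-1%R (C * (1 + C * expR C))%R g' &
    g = z ^+ m * g'].
Proof.
move=> n0 Sz; have n'0 := invn_ge0 n.
have e0 (x : R) : (0 <= expR x)%R by exact: expR_ge0.
elim=> [{}C C0|w u {}C {}g D [Su wu] Wg [m [g' [mC Wg' eq_g]]] le_D].
  exists 0%N, 1; rewrite mul0r mulg1; split=> //.
  by apply: word_nil; rewrite mulr_ge0 ?addr_ge0 ?mulr_ge0.
have C0 : (0 <= C)%R := word_ge0 n'0 Wg.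
have ew0 : (0 <= n%:R^-1 ^+ w :> R)%R by rewrite exprn_ge0.
have CD : (C <= D)%R by apply: le_trans le_D; rewrite lerDr.
have D0 := le_trans C0 CD.
have leK : (1 + C * expR C <= 1 + D * expR D)%R.
  by rewrite lerD2l ler_pM // ler_expR.
have [[wi uz]|Lu] : (w = i /\ u = z) \/ letter_from i L w u.
- case: wu => [iw|[wi]]; first by right; split=> //; left.
  rewrite inE => /orP[/eqP ->|uL]; first by left.
  by right; split=> //; right.
- subst w u; exists m.+1, g'; split; last by rewrite expgS -mulgA eq_g.
    by rewrite -natr1 mulrDl mul1r addrC (le_trans _ le_D) // lerD2l.
  by apply: (word_le Wg'); rewrite ler_pM // addr_ge0 // mulr_ge0.
exists m, (u * ([~ u, z ^+ m] * g')); split.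
- exact: le_trans CD.
- have Vzm : V n i (m%:R * n%:R^-1 ^+ i)%R (z ^+ m).
    by apply: word_exp; apply: comm_word_letter.
  have Vuzm : V n i.+1 (n%:R^-1 ^+ w * (D * expR D))%R [~ u, z ^+ m].
    have Vc := comm_word_comm n'0 (comm_word_letter _ Su) Vzm.
    apply: word_le (comm_word_weight _ Vc) _.
      by rewrite -add1n leq_add2r (iter_comm_gt0 Su).
    rewrite -[leLHS]mulrA ler_wpM2l // ler_pM ?mulr_ge0 ?exprn_ge0 //.
      exact: le_trans CD.
    by rewrite ler_expR (le_trans _ le_D) // lerD2l.
  apply: word_cons Lu (word_mul (comm_word_letter_from L Vuzm) Wg') _.
  apply: (@le_trans _ _ ((n%:R^-1 ^+ w + C) * (1 + D * expR D))%R).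
    by rewrite mulrDl [in leRHS]mulrDr mulr1 -addrA !lerD2l ler_wpM2l.
  by rewrite ler_wpM2r // addr_ge0 // mulr_ge0.
by rewrite eq_g; clear; move: (z ^+ m) => y; mulg_norm.
Qed.

Definition ball_covering (B : nat) : Prop := forall C : nat,
  exists l, forall n, (0 < n)%N -> exists2 X : seq G, (size X <= l)%N &
    forall g, set_expg S (C * n)%N g -> exists x b,
      [/\ x \in X, set_expg S (B * n)%N b & g = x * b].

(** Intermediate stage of [ball_covering]: [v] is the part of the word still to be treated, and [L]
    lists the letters of weight [i] not yet removed. [K] may depend on [C], but [B] may not. *)
Definition letter_covering (B i : nat) (L : seq G) : Prop := forall C : R,
  exists K l, forall n, (0 < n)%N -> exists2 X : seq G, (size X <= l)%N &
    forall g, V n 1 C g -> exists x v b,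
      [/\ x \in X, word (letter_from i L) n%:R^-1%R K v, set_expg S (B * n)%N b
        & g = x * v * b].

Lemma letter_covering_cons B i z L : iter_comm S i z ->
  letter_covering B i (z :: L) -> exists B', letter_covering B' i L.
Proof.
move=> Sz covB; have [Kz [Lz near_z]] := iter_comm_exp_near_ball Sz.
exists (Lz + B)%N => C; have [K [l cov]] := covB C.
(* Bounds the quotients [m %/ n ^ i], since [m] letters of weight [i] cost [m / n ^ i], at most
   [K]. *)
pose q_max := Num.bound K.
pose Kx := (K * (1 + K * expR K))%R.
exists (Kz + (Kx + Kx * Lz%:R * expR (Kx + Lz%:R)))%R, (l * q_max)%N => n n0.
have [X sX covX] := cov n n0.
exists [seq x * z ^+ (q * n ^ i) | x <- X, q <- iota 0 q_max].
  by rewrite size_allpairs size_iota leq_mul2r sX orbT.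
move=> g /covX [x [v [b [xX Wv Sb eq_g]]]].
have K0 := word_ge0 (invn_ge0 n) Wv.
have [m [v' [mK Wv' eq_v]]] := word_extract n0 Sz Wv.
have ni0 : (0 < n ^ i)%N by rewrite expn_gt0 n0.
have [e [bz [Ve Sbz eq_z]]] := near_z n (m %% n ^ i)%N n0 (ltnW (ltn_pmod m ni0)).
exists (x * z ^+ (m %/ n ^ i * n ^ i)), (e * v' ^ bz^-1), (bz * b); split.
- apply: allpairs_f => //; rewrite mem_iota /= add0n -(ltr_nat R).
  apply: le_lt_trans (archi_boundP K0); apply: le_trans mK.
  by rewrite exprVn ler_pdivlMr -natrX ?ltr0n // -natrM ler_nat leq_divM.
- apply: word_mul; first exact: comm_word_letter_from.
  (* A bound on the conjugate from [comm_word_conj] would forget [L]; the commutator has weight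
     above [i], so the letters of weight [i] remain those of [v']. *)
  rewrite -(mulVKg v' (v' ^ _)) -commgEl; apply: word_mul => //.
  have Vc := comm_word_comm (invn_ge0 n) (letter_from_comm_word Wv')
    (ball_word n0 (set_expgV SV Sbz)).
  apply: comm_word_letter_from; apply: comm_word_weight Vc.
  by rewrite addn1.
- by rewrite mulnDl; apply: set_expg_mul.
rewrite eq_g eq_v [in LHS](divn_eq m (n ^ i)) expgnDr eq_z.
by mulg_norm.
Qed.

Lemma letter_covering_nil B i L : letter_covering B i L ->
  (forall z, z \in L -> iter_comm S i z) ->
  exists B', letter_covering B' i [::].
Proof.
elim: L B => [|z L IH] B covB SL; first by exists B.
have [B' covB'] := letter_covering_cons (SL z (mem_head z L)) covB.
by apply: IH covB' _ => u uL; apply: SL; rewrite inE uL orbT.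
Qed.

Hypothesis S_fin : finite_set S.

(** Both entries of a commutator have smaller positive weight, so strong induction applies. *)
Lemma finite_iter_comm w : finite_set [set u | iter_comm S w u].
Proof.
elim/ltn_ind: w => w IH.
apply: (@sub_finite_set _ _ (S `|` \bigcup_(p in [set p | (0 < p < w)%N])
   [set [~ u, v] | u in [set u | iter_comm S p u] &
                   v in [set v | iter_comm S (w - p) v]])).
  move=> _ /= [s Ss|p q u v Su Sv]; first by left.
  right; exists p => /=.
    by rewrite (iter_comm_gt0 Su) -[X in (X < _)%N]addn0 ltn_add2l (iter_comm_gt0 Sv).
  by exists u => //; exists v => //=; rewrite addnC addnK.
rewrite finite_setU; split => //; apply: bigcup_finite.
  by apply: (sub_finite_set _ (finite_II w)) => p /= /andP[].
move=> p /andP[p0 pw]; apply: finite_image2; apply: IH => //.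
by rewrite ltn_subrL p0 (ltn_trans p0).
Qed.

Lemma iter_comm_enum w : exists L : seq G, forall u, u \in L <-> iter_comm S w u.
Proof.
have [L eqL] := (finite_seqP _).1 (finite_iter_comm w).
by exists L => u; rewrite -[iter_comm S w u]/([set u | iter_comm S w u] u) eqL.
Qed.

Lemma letter_covering_sub B i i' L L' :
  (forall w u, letter_from i L w u -> letter_from i' L' w u) ->
  letter_covering B i L -> letter_covering B i' L'.
Proof.
move=> sub covB C; have [K [l cov]] := covB C.
exists K, l => n n0; have [X sX covX] := cov n n0.
exists X => // g /covX [x [v [b [xX /(word_sub sub) Wv Sb eq_g]]]].
by exists x, v, b.
Qed.

Lemma letter_covering_weight i : exists B, letter_covering B i.+1 [::].
Proof.
elim: i => [|i [B covB]].
  have [L memL] := iter_comm_enum 1.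
  (* At the start nothing has been moved: [v] is the whole word, and [x] and [b] are trivial. *)
  apply: (@letter_covering_nil 0 1 L) => [C|z /memL //].
  exists C, 1%N => n n0; exists [:: 1] => // g Vg.
  exists 1, g, 1; split; rewrite ?mem_seq1 ?mulg1 ?mul1g //.
  apply: word_sub Vg => w u [Su]; rewrite leq_eqVlt => /orP[/eqP w1|w1].
    by split=> //; right; split=> //; apply/memL; rewrite w1.
  by split=> //; left.
have [L memL] := iter_comm_enum i.+2.
apply: (@letter_covering_nil B i.+2 L) => [|z /memL //].
apply: (letter_covering_sub _ covB) => w u [Su [|[]//]].
rewrite leq_eqVlt => /orP[/eqP iw|iw]; split=> //; [right|by left].
by split=> //; apply/memL; rewrite iw.
Qed.

Lemma ball_covering_nilpotent c :
  (forall w u, (c <= w)%N -> iter_comm S w u -> u = 1) ->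
  exists B, ball_covering B.
Proof.
move=> nilS; have [B covB] := letter_covering_weight c.
exists B => C; have [K [l cov]] := covB C%:R%R.
exists l => n n0; have [X sX covX] := cov n n0.
exists X => // g /(ball_word n0) /covX [x [v [b [xX Wv Sb ->]]]].
exists x, b; split=> //; suff -> : v = 1 by rewrite mulg1.
elim: Wv => // w u _ {}v _ [Su wu] _ -> _; rewrite mulg1.
by apply: nilS Su; case: wu => [/ltnW/ltnW//|[->]].
Qed.

End Balls.
End CommutatorWords.

(** * From nilpotent to virtually nilpotent groups *)

Section VirtuallyNilpotent.
Variables (R : realType) (G : groupType).
Implicit Types (S : set G).

(* A bracketing of weight [2 ^ k] contains a leaf of depth at least [k]; this
   crude bound makes [[gamma_p, gamma_q] <= gamma_(p + q)] unnecessary. *)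
Lemma iter_comm_lower_central (N S : set G) w u k : is_subgroup N -> S `<=` N ->
  iter_comm S w u -> (2 ^ k <= w)%N -> lower_central N k u.
Proof.
move=> [N1 NM NV] SN Su.
suff [lowS _] : (forall k, (2 ^ k <= w)%N -> lower_central N k u) /\ N u.
  by apply: lowS.
elim: Su => [s /SN Ns|p q {}u v _ [IHu Nu] _ [IHv Nv]].
  by split=> // -[|k'] //; rewrite expnS leqNgt leq_pmulr // expn_gt0.
have Nuv : N [~ u, v].
  exact: NM _ _ (NV _ Nu) (NM _ _ (NV _ Nv) (NM _ _ Nu Nv)).
split=> // -[//|k']; rewrite expnS mul2n -addnn => pq_k.
have [|] : (2 ^ k' <= p \/ 2 ^ k' <= q)%N by lia.
  by move=> /IHu uk B [_]; apply; exists u => //; exists v.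
move=> /IHv vk B [[_ _ BV] EB]; rewrite -invgR; apply/BV/EB.
by exists v => //; exists u.
Qed.

Lemma generated_set_expg S x : S 1 -> (forall s, S s -> S s^-1) ->
  generated S x -> exists m, set_expg S m x.
Proof.
move=> S1 SV Sx; apply: (Sx [set y | exists m, set_expg S m y]).
split; last by move=> s Ss; exists 1%N; apply: set_expg1.
split; first by exists 0%N.
  by move=> y z [a Sy] [b Sz]; exists (a + b)%N; apply: set_expg_mul.
by move=> y [a Sy]; exists a; apply: set_expgV.
Qed.

Lemma set_expg_generated S m x : set_expg S m x -> generated S x.
Proof.
move=> + B [[B1 BM _] SB].
by elim: m x => [x ->//|m IH x [s /SB Bs [y /IH By <-]]]; apply: BM.
Qed.

Lemma generated_subgroup S : is_subgroup (generated S).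
Proof.
split=> [B [[]]//|x y Sx Sy B BS|x Sx B BS]; have [[B1 BM BV] SB] := BS.
  by apply: BM; [apply: Sx|apply: Sy].
by apply: BV; apply: Sx.
Qed.

Lemma sub_generated S : S `<=` generated S.
Proof. by move=> s Ss B [_]; apply. Qed.

Lemma finite_sub_set_expg S T : S 1 -> (forall s, S s -> S s^-1) ->
  finite_set T -> T `<=` generated S -> exists q, T `<=` set_expg S q.
Proof.
move=> S1 SV /finite_seqP[L ->]; elim: L => [|x L IH] LS; first by exists 0%N.
have [m Sx] : exists m, set_expg S m x.
  by apply: generated_set_expg => //; apply: LS; rewrite /= mem_head.
have [|q Lq] := IH; first by move=> y yL; apply: LS; rewrite /= inE yL orbT.
exists (maxn m q) => y /=; rewrite inE => /orP[/eqP ->|yL].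
  exact: set_expg_le (leq_maxl _ _) Sx.
exact: set_expg_le (leq_maxr _ _) (Lq _ yL).
Qed.

Lemma finite_index_transversal (N H : set G) : is_subgroup N -> H 1 ->
  finite_index N ->
  exists F : set G, [/\ finite_set F, F 1, F `<=` H &
    forall g, H g -> exists2 f, F f & N (f^-1 * g)].
Proof.
move=> [N1 NM NV] H1 finN.
pose coset x := [set x * y | y in N].
(* The default value [1] lies in [H], so even a coset disjoint from [H] contributes an element of
   [H]. *)
pose pick (D : set G) := xget 1 (D `&` H).
exists ([set 1] `|` [set pick D | D in [set coset x | x in [set: G]]]); split.
- by rewrite finite_setU; split=> //; apply: finite_image.
- by left.
- move=> _ [->//|[D _ <-]]; rewrite /pick; case: xgetP => [y -> []//|_ //].
move=> g Hg; have Dg : (coset g `&` H) g by split=> //; exists 1; rewrite ?mulg1.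
have [[y Ny gy] _] := xgetPex 1 (ex_intro _ g Dg).
exists (pick (coset g)); first by right; exists (coset g) => //; exists g.
by rewrite /pick -gy invgM mulgVK; apply: NV.
Qed.

(* [T] consists of Schreier's generators of the finite index subgroup. *)
Lemma ball_covering_virtually_nilpotent S : virtually_nilpotent G ->
  finite_set S -> S 1 -> (forall s, S s -> S s^-1) ->
  exists B, ball_covering S B.
Proof.
move=> [N [subN [c nilN]] finN] finS S1 SV.
have [N1 NM NV] := subN; have [H1 HM HV] := generated_subgroup S.
have [F [finF F1 FH coverF]] := finite_index_transversal subN H1 finN.
pose T := [set t | N t /\ exists f f' s, [/\ F f, F f', S s & t = f'^-1 * s * f]].
have finT : finite_set T.
  apply: (@sub_finite_set _ _
    [set x * f | x in [set f' * s | f' in [set f^-1 | f in F] & s in S] & f in F]).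
    move=> _ [_ [f [f' [s [Ff Ff' Ss ->]]]]] /=.
    exists (f'^-1 * s); last by exists f.
    by exists f'^-1; [exists f'|exists s].
  by do ?apply: finite_image2 => //; apply: finite_image.
have T1 : T 1.
  by split=> //; exists 1, 1, 1; split; rewrite ?invg1 ?mulg1.
have TV t : T t -> T t^-1.
  move=> [/NV Nt [f [f' [s [Ff Ff' /SV Ss eq_t]]]]]; split=> //.
  by exists f', f, s^-1; split; rewrite // eq_t !invgM invgK mulgA.
have TH : T `<=` generated S.
  move=> _ [_ [f [f' [s [/FH Hf /FH Hf' /sub_generated Hs ->]]]]].
  exact: (HM _ _ (HM _ _ (HV _ Hf') Hs) Hf).
have [q Tq] := finite_sub_set_expg S1 SV finT TH.
have [B covB] : exists B, ball_covering T B.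
  apply: (@ball_covering_nilpotent R G T TV T1 finT (2 ^ c)%N) => w u cw Tu.
  suff : lower_central N c u by rewrite nilN.
  by apply: iter_comm_lower_central Tu cw => // t [].
(* Schreier rewriting: [s * f = f' * t] with [t] in [T] carries the coset representative to the
   left, and one letter of [S] yields one of [T]. *)
have coset_expg m g : set_expg S m g ->
    exists f t, [/\ F f, set_expg T m t & g = f * t].
  elim: m g => [g ->|m IH g [s Ss [g' /IH [f [t [Ff Tt ->]]] <-]]].
    by exists 1, 1; rewrite mulg1.
  have [f' Ff' Nf'] : exists2 f', F f' & N (f'^-1 * (s * f)).
    by apply: coverF; apply: HM; [exact: sub_generated|exact: FH].
  exists f', (f'^-1 * (s * f) * t); split=> //; last by mulg_norm.
  exists (f'^-1 * (s * f)); last by exists t.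
  by split=> //; exists f, f', s; rewrite mulgA.
have [Fs eqF] := (finite_seqP _).1 finF.
exists (B * q)%N => C; have [l cov] := covB C.
exists (size Fs * l)%N => n n0; have [X sX covX] := cov n n0.
exists [seq f * x | f <- Fs, x <- X]; first by rewrite size_allpairs leq_mul2l sX orbT.
move=> _ /coset_expg [f [_ [Ff /covX [x [b [xX Tb ->]]] ->]]].
exists (f * x), b; split; last by rewrite mulgA.
  by apply: allpairs_f => //; move: Ff; rewrite eqF.
rewrite mulnAC; apply: set_expg_powM; exact: set_expg_subset Tb.
Qed.

(** * From ball coverings to powers of [A] *)

Lemma word_ball_set_expg S m (n : int) g : set_expg S m g -> (m%:Z <= n)%R ->
  word_ball S n g.
Proof.
move=> Sg mn; split; first exact: set_expg_generated Sg.
apply: le_trans mn; rewrite lez_nat /word_length.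
case: pselect => [ex|[]]; last by exists m; apply/asboolP.
by case: ex_minnP => k _; apply; apply/asboolP.
Qed.

Lemma card_le_seq (X : seq G) l : (size X <= l)%N -> ([set` X] #<= `I_l)%card.
Proof.
move=> sX; apply: (@card_le_trans _ _ _ `I_(size X)); last by rewrite card_le_II.
apply: card_le_trans (card_image_le (nth 1 X) _); apply: subset_card_le.
by move=> x /= xX; exists (index x X); rewrite ?nth_index // /= index_mem.
Qed.

End VirtuallyNilpotent.

Theorem proposition4p1 (R : realType) (G : groupType) (A S : set G)
    (theta : R) (h1 : nat) :
  virtually_nilpotent G ->
  finite_set A ->
  A !=set0 ->
  S `<=` generated A ->
  finite_set S ->
  symmetric_set S ->
  generated S = generated A ->
  S 1 ->
  (0 < theta)%R ->
  (0 < h1)%N ->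
  (forall h : nat, (h1 <= h)%N ->
     word_ball S (Num.floor (theta * h%:R)%R) `<=` set_expg A h) ->
  asymptotic_approximate_group A.
Proof.
move=> nilG finA A0 _ finS symS genS S1 theta0 _ ballA r r0.
have SV s : S s -> S s^-1 by move=> Ss; rewrite -symS; exists s.
have [B covB] := ball_covering_virtually_nilpotent R nilG finS S1 SV.
have [k Ak] : exists k, A `<=` set_expg S k.
  by apply: finite_sub_set_expg => //; rewrite genS; apply: sub_generated.
(* [M * n] will bound the radius [r * h * k] of the ball containing the power [r * h] of [A]. As [M]
   depends on [B], it matters that [B] was fixed before the radius to be covered; [M] does not
   depend on [h], hence neither does [l]. *)
pose M := Num.bound (2 * (r * k)%:R * B.+1%:R / theta)%R.
have M_ge : (2 * (r * k)%:R * B.+1%:R / theta <= M%:R)%R.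
  by apply/ltW/archi_boundP; rewrite divr_ge0 ?mulr_ge0 // ltW.
have [l cov] := covB M.
exists l.+1 => //; split=> //.
(* The last bound makes the scale [n] below positive; [B.+1] instead of [B] avoids division by
   zero. *)
exists (maxn 1 (maxn h1 (Num.bound (B.+1%:R / theta)%R))); first by rewrite leq_max.
move=> h; rewrite !geq_max => /and3P[h0 h1h hB].
have {}hB : (B.+1%:R <= theta * h%:R :> R)%R.
  rewrite mulrC -ler_pdivrMr //; apply: le_trans (_ : _ <= (Num.bound _)%:R)%R _.
    by apply/ltW/archi_boundP; rewrite divr_ge0 // ltW.
  by rewrite ler_nat.
have th0 : (0 <= theta * h%:R / B.+1%:R)%R by rewrite divr_ge0 // mulr_ge0 // ltW.
pose n := Num.truncn (theta * h%:R / B.+1%:R)%R.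
have /andP[n_le n_gt] := truncn_itv th0; rewrite -/n in n_le n_gt.
have n0 : (0 < n)%N.
  rewrite truncn_gt0 ler_pdivlMr ?mul1r //.
have [X sX covX] := cov n n0.
exists [set` X]; first exact: card_le_seq (leqW sX).
move=> g Ag.
have Sg : set_expg S (M * n)%N g.
  apply: (set_expg_le S1 (a := (r * h * k)%N)); last first.
    by apply: set_expg_powM; apply: set_expg_subset Ag.
  (* The factor 2 absorbs the rounding in [n]: [n + 1 <= 2 * n]. *)
  have h_le : (h%:R <= 2 * n%:R * B.+1%:R / theta)%R.
    rewrite ler_pdivlMr // mulrC; apply/ltW; move: n_gt; rewrite ltr_pdivrMr //.
    move=> /lt_le_trans; apply; rewrite ler_wpM2r // -natrM ler_nat; lia.
  rewrite -(ler_nat R) mulnAC natrM [in leRHS]natrM.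
  apply: le_trans (ler_wpM2l (ler0n _ _) h_le) _.
  apply: le_trans (ler_wpM2r (ler0n _ n) M_ge).
  by rewrite le_eqVlt; apply/orP; left; apply/eqP; ring.
have [x [b [xX Sb ->]]] := covX g Sg.
(* Since [B * n <= theta * h], the translated ball lies in the power [h] of [A]. *)
exists x => //; exists b => //; apply: ballA => //.
apply: word_ball_set_expg Sb _; rewrite floor_ge_int.
move: n_le; rewrite ler_pdivlMr // => /(le_trans _); apply.
by rewrite -natrM ler_nat mulnC leq_mul2l leqnSn orbT.
Qed.
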